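(* Let $f$ be a non-degenerate Hermitian or quadratic form of finite Witt index $n\ge2$ on a vector space $V$ over a field, of finite anisotropic defect $d$ (so $\dim V=2n+d$), with polar space $\mathcal P=\mathcal P(f)$ not a grid. Then every chain of $\mathfrak N(\mathcal P)$ has length at most $d$, and the maximal chains of $\mathfrak N(\mathcal P)$ are exactly those of length $d$.
   Context: Anisotropic defect: $V=V_1\oplus\cdots\oplus V_n\oplus V_0$ with $V_i$ pairwise orthogonal hyperbolic planes and $V_0$ anisotropic and orthogonal to them; $d=\dim V_0$. Points of $\mathcal P(f)$: isotropic/singular 1-spaces; lines: totally isotropic/singular 2-spaces; ''not a grid'' excludes $f$ quadratic with $n=2$, $\dim V=4$. A subspace is a set of points containing every line meeting it in $\ge2$ points; a nice subspace is a subspace containing two mutually disjoint maximal singular subspaces of $\mathcal P$; $\mathfrak N(\mathcal P)$ is the set of nice subspaces ordered by inclusion. The length of a chain is its cardinality minus $1$. *)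

(* Defs.v *)
From HB Require Import structures.
From mathcomp Require Import all_boot all_order all_algebra.
Set Implicit Arguments. Unset Strict Implicit. Unset Printing Implicit Defensive.
Import GRing.Theory.
Local Open Scope ring_scope.

Section PolarSpace.
Variables (K : fieldType) (vT : vectType K).

Inductive pform :=
  | Herm of {rmorphism K -> K} & (vT -> vT -> K)
  | Quad of (vT -> K).

Definition polar (q : vT -> K) (x y : vT) : K := q (x + y) - q x - q y.

Definition bil (F : pform) : vT -> vT -> K :=
  match F with Herm _ f => f | Quad q => polar q end.

Definition sing (F : pform) (x : vT) : Prop :=
  match F with Herm _ f => f x x = 0 | Quad q => q x = 0 end.

Definition nondeg_form (F : pform) : Prop :=
  match F with
  | Herm sigma f =>
      [/\ forall a x y z, f (a *: x + y) z = a * f x z + f y z,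
          forall x y, f y x = sigma (f x y),
          forall a, sigma (sigma a) = a,
          exists a, sigma a <> a
        & forall x, (forall y, f x y = 0) -> x = 0]
  | Quad q =>
      [/\ forall a x, q (a *: x) = a ^+ 2 * q x,
          forall a x y z, polar q (a *: x + y) z = a * polar q x z + polar q y z
        & forall x, q x = 0 -> (forall y, polar q x y = 0) -> x = 0]
  end.

Definition is_quadratic (F : pform) : bool :=
  match F with Herm _ _ => false | Quad _ => true end.

Variable F : pform.

Definition tot_sing (U : {vspace vT}) : Prop :=
  (forall x, x \in U -> sing F x) /\
  (forall x y, x \in U -> y \in U -> bil F x y = 0).

Definition witt_index (n : nat) : Prop :=
  (exists U, tot_sing U /\ \dim U = n) /\
  (forall U, tot_sing U -> (\dim U <= n)%N).

Definition orthv (U W : {vspace vT}) : Prop :=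
  forall x y, x \in U -> y \in W -> bil F x y = 0.

Definition hyperbolic_plane (H : {vspace vT}) : Prop :=
  exists e f, [/\ sing F e, sing F f, bil F e f = 1 & H = <<[:: e; f]>>%VS].

Definition anisotropic (U : {vspace vT}) : Prop :=
  forall x, x \in U -> sing F x -> x = 0.

Definition anisotropic_defect (n d : nat) : Prop :=
  exists (Vs : 'I_n -> {vspace vT}) (V0 : {vspace vT}),
    (forall i, hyperbolic_plane (Vs i)) /\
    (forall i j, i != j -> orthv (Vs i) (Vs j)) /\
    (forall i, orthv (Vs i) V0) /\
    anisotropic V0 /\
    (\sum_(i < n) Vs i + V0)%VS = fullv /\
    directv (\sum_(i < n) Vs i + V0) /\
    \dim V0 = d.

Definition is_grid (n : nat) : Prop :=
  is_quadratic F /\ n = 2%N /\ \dim (fullv : {vspace vT}) = 4%N.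

Definition is_point (p : {vspace vT}) : Prop := \dim p = 1%N /\ tot_sing p.
Definition is_line (L : {vspace vT}) : Prop := \dim L = 2%N /\ tot_sing L.

Definition pset := {vspace vT} -> Prop.
Definition psub (X Y : pset) : Prop := forall p, X p -> Y p.
Definition pseteq (X Y : pset) : Prop := forall p, X p <-> Y p.

Definition collinear (p q : {vspace vT}) : Prop :=
  exists L, [/\ is_line L, (p <= L)%VS & (q <= L)%VS].

Definition psubspace (X : pset) : Prop :=
  (forall p, X p -> is_point p) /\
  (forall L, is_line L ->
     (exists p q, [/\ p != q, X p, X q, (p <= L)%VS & (q <= L)%VS]) ->
     forall p, is_point p -> (p <= L)%VS -> X p).

Definition singular_subspace (X : pset) : Prop :=
  psubspace X /\ (forall p q, X p -> X q -> p != q -> collinear p q).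

Definition max_singular (X : pset) : Prop :=
  singular_subspace X /\
  (forall Y, singular_subspace Y -> psub X Y -> psub Y X).

Definition nice (X : pset) : Prop :=
  psubspace X /\
  exists M1 M2, [/\ max_singular M1, max_singular M2, psub M1 X, psub M2 X
                  & forall p, M1 p -> M2 p -> False].

(* chains of N(P): collections of nice subspaces totally ordered by inclusion;
   elements are counted up to extensional equality of point sets *)
Definition chain (C : pset -> Prop) : Prop :=
  (forall X, C X -> nice X) /\
  (forall X Y, C X -> C Y -> psub X Y \/ psub Y X).

Definition chain_len_le (C : pset -> Prop) (k : nat) : Prop :=
  forall m (X : 'I_m -> pset), (forall i, C (X i)) ->
    (forall i j, i != j -> ~ pseteq (X i) (X j)) -> (m <= k.+1)%N.

Definition chain_len_eq (C : pset -> Prop) (k : nat) : Prop :=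
  exists X : 'I_k.+1 -> pset,
    [/\ forall i, C (X i),
        forall i j, i != j -> ~ pseteq (X i) (X j)
      & forall Y, C Y -> exists i, pseteq Y (X i)].

Definition maximal_chain (C : pset -> Prop) : Prop :=
  chain C /\
  forall X, nice X -> (forall Y, C Y -> psub X Y \/ psub Y X) ->
    exists Y, C Y /\ pseteq X Y.

End PolarSpace.

(* Main.v *)
Require Import Defs.
From HB Require Import structures.
From mathcomp Require Import all_boot all_order all_algebra.
From mathcomp Require Import boolp ring.
Set Implicit Arguments. Unset Strict Implicit. Unset Printing Implicit Defensive.
Import GRing.Theory.
Local Open Scope ring_scope.

(* Every nice subspace X is the set of all singular points of its linear span, so nice
   subspaces correspond to the subspaces U of V containing two disjoint maximal totally
   singular subspaces A and B; these satisfy 2n <= dim U <= 2n + d, and U can be refined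
   freely in between, whence the statement on chains.

   To see that X comes from a linear subspace, work with the set S of vectors spanning
   points of X: it is closed under scaling and under sums of orthogonal vectors. As A and
   B are dually paired, V is the orthogonal sum of H = A + B and of an anisotropic part D.
   First, S contains all singular vectors of H. Next, if h + c is in S with h in H and c
   in D, then so is h' + c for every h' in H of the same norm, because h' can be reached
   from h by successively adding singular vectors of H orthogonal to the current one.
   Hence the components in D of the vectors of S form a linear subspace: given c and c',
   one can choose h and h' so that h + c and h' + c' lie in S and are orthogonal. *)

(** * Linear algebra preliminaries *)

Section Vspace.
Variables (K : fieldType) (vT : vectType K).

Lemma linear_lfun (rT : vectType K) (g : vT -> rT) :
  linear g -> exists phi : 'Hom(vT, rT), phi =1 g.
Proof.
move=> g_lin; pose G : {linear vT -> rT} :=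
  HB.pack g (GRing.isLinear.Build K vT rT *:%R g g_lin).
by exists (linfun G) => x; rewrite lfunE.
Qed.

(** Among the subspaces contained in [P], one of maximal dimension absorbs every vector of [P],
    since adjoining such a vector gives a subspace still contained in [P]. *)
Lemma vspace_of_pred (P : vT -> Prop) :
  P 0 -> (forall a x y, P x -> P y -> P (a *: x + y)) ->
  exists W : {vspace vT}, forall v, v \in W <-> P v.
Proof.
move=> P0 Plin.
pose Q k := `[< exists U : {vspace vT}, (forall v, v \in U -> P v) /\ \dim U = k >].
have exQ : exists k, Q k.
  exists 0%N; apply/asboolP; exists 0%VS; split; last exact: dimv0.
  by move=> v; rewrite memv0 => /eqP->.
have bQ k : Q k -> (k <= \dim {:vT})%N.
  by move=> /asboolP[U [_ <-]]; rewrite dimvS ?subvf.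
case: (ex_maxnP exQ bQ) => k /asboolP[U [UP dU]] kmax.
exists U => v; split; first exact: UP.
move=> Pv; have : (\dim (<[v]> + U) <= \dim U)%N.
  rewrite dU; apply: kmax; apply/asboolP; exists (<[v]> + U)%VS; split=> //.
  by move=> w /memv_addP[_ /vlineP[c ->] [u uU ->]]; apply: Plin => //; exact: UP.
move=> le; have /eqP-> : U == (<[v]> + U)%VS by rewrite eqEdim addvSr.
by apply: (subvP (addvSl _ _)); exact: memv_line.
Qed.

Lemma exists_between (U W : {vspace vT}) k :
  (U <= W)%VS -> (\dim U <= k <= \dim W)%N ->
  exists X : {vspace vT}, [/\ (U <= X)%VS, (X <= W)%VS & \dim X = k].
Proof.
move=> UW /andP[leUk]; elim: k leUk => [|k IH].
  by rewrite leqn0 => /eqP dU _; exists U.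
rewrite leq_eqVlt => /orP[/eqP dU _|ltUk ltkW]; first by exists U.
have [X [UX XW dX]] := IH ltUk (ltnW ltkW).
have /subvPn[w wW wX] : ~~ (W <= X)%VS.
  by apply: contraL ltkW => /dimvS; rewrite dX -leqNgt.
exists (X + <[w]>)%VS; split.
- exact: subv_trans UX (addvSl _ _).
- by rewrite subv_add XW -memvE.
rewrite dimv_disjoint_sum ?dX ?dim_vline.
  by case: eqP wX => [->|]; rewrite ?mem0v ?addn1.
apply/eqP; rewrite -subv0; apply/subvP=> x /memv_capP[xX /vlineP[c xE]].
rewrite memv0 xE; have [->|c0] := eqVneq c 0; first by rewrite scale0r.
by case/negP: wX; rewrite -(scale1r w) -(mulVf c0) -scalerA -xE memvZ.
Qed.

Lemma basis_functional (b b' : vT) (k k' : K) :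
  free [:: b; b'] -> exists phi : vT -> K,
    [/\ forall a x y, phi (a *: x + y) = a * phi x + phi y, phi b = k & phi b' = k'].
Proof.
move=> fr; pose X := [tuple b; b'].
exists (fun v => k * coord X ord0 v + k' * coord X ord_max v); split.
- by move=> a x y; rewrite !linearP /=; ring.
- have -> : b = X`_(@ord0 1) by [].
  by rewrite !coord_free //= mulr1 mulr0 addr0.
have -> : b' = X`_(@ord_max 1) by [].
by rewrite !coord_free //= mulr1 mulr0 add0r.
Qed.

Lemma free2P (b b' : vT) : b' != 0 -> (forall c, b <> c *: b') -> free [:: b; b'].
Proof.
move=> b0 nb; rewrite free_cons span_seq1 seq1_free b0 andbT.
by apply/negP=> /vlineP[c bE]; apply: (nb c).
Qed.

Lemma exists_free2 (U : {vspace vT}) : (2 <= \dim U)%N ->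
  exists b b', [/\ b \in U, b' \in U & free [:: b; b']].
Proof.
move=> dU.
have [X [_ XU dX]] : exists X : {vspace vT}, [/\ (0 <= X)%VS, (X <= U)%VS & \dim X = 2%N].
  by apply: exists_between; rewrite ?sub0v // dimv0.
have sX : size (vbasis X) = 2%N by rewrite size_tuple dX.
have := vbasisP X; case: (tval (vbasis X)) sX => [|b [|b' [|]]] //= _ bX.
exists b, b'; split; last exact: basis_free bX.
  by apply/(subvP XU)/(basis_mem bX); rewrite !inE eqxx.
by apply/(subvP XU)/(basis_mem bX); rewrite !inE eqxx orbT.
Qed.

End Vspace.

(** * A common axiomatisation of Hermitian and quadratic forms *)

Section Form.
Variables (K : fieldType) (vT : vectType K).

Definition pnorm (F : pform vT) (x : vT) : K :=
  match F with Herm _ f => f x x | Quad q => q x end.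

Lemma singE (F : pform vT) x : sing F x = (pnorm F x = 0).
Proof. by case: F. Qed.

(* The common behaviour of both kinds of forms: [s] is the involution (trivial
   in the quadratic case) and [T] the trace ([t + s t], resp. [t]). *)
Record form_laws (F : pform vT) (s : {rmorphism K -> K}) (T : K -> K) : Prop := FormLaws {
  bil_linear : forall a x y z, bil F (a *: x + y) z = a * bil F x z + bil F y z;
  bil_conj : forall x y, bil F y x = s (bil F x y);
  conjK : forall a, s (s a) = a;
  pnormD : forall x y, pnorm F (x + y) = pnorm F x + pnorm F y + T (bil F x y);
  pnormZ : forall a x, pnorm F (a *: x) = a * s a * pnorm F x;
  traceD : forall a b, T (a + b) = T a + T b;
  trace_eq0 : forall u, T u = 0 -> exists k, u = k - s k;
  trace_onto : forall x, exists t, T t = pnorm F x;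
  pnorm_bil : forall x, pnorm F x = 0 -> bil F x x = 0 }.

(** In the Hermitian case the trace laws rest on an element [th] with [th + s th = 1]. In the
    quadratic case [s] and [T] are identities. *)
Lemma nondeg_form_laws (F : pform vT) :
  nondeg_form F -> exists s T, form_laws F s T.
Proof.
case: F => [s f|q] /=.
  case=> fl fs ss [a0 sa0] _; exists s, (fun t => t + s t).
  have [th thE] : exists th, th + s th = 1.
    (* The choice [c = 1] works unless 2 = 0; then [-1 = 1], and any element moved by [s] has
       nonzero trace. *)
    have [c cN0] : exists c, c + s c != 0.
      have [h|] := eqVneq (1 + s 1) 0; last by exists 1.
      exists a0; apply/eqP=> h0; apply: sa0.
      have m1 : -1 = 1 :> K by apply/eqP; rewrite eq_sym -subr_eq0 opprK -{2}(rmorph1 s) h.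
      by apply/eqP; rewrite -subr_eq0 -[- a0]mulN1r m1 mul1r addrC h0.
    exists (c / (c + s c)); rewrite fmorph_div rmorphD ss (addrC (s c)).
    by rewrite -mulrDl divff.
  have fD x y z : f (x + y) z = f x z + f y z by have := fl 1 x y z; rewrite scale1r mul1r.
  have fZ a x z : f (a *: x) z = a * f x z.
    by have := fl a x 0 z; rewrite addr0 => ->; have := fl (-1) z z z;
       rewrite scaleN1r addNr mulN1r addNr => ->; rewrite addr0.
  have fDr x y z : f z (x + y) = f z x + f z y by rewrite fs fD rmorphD -!fs.
  have fZr a x z : f z (a *: x) = s a * f z x by rewrite fs fZ rmorphM -fs.
  split=> //=.
  - by move=> x y; rewrite fD !fDr (fs x y); ring.
  - by move=> a x; rewrite fZ fZr mulrA.
  - by move=> a b; rewrite rmorphD; ring.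
  (* As [s u = - u], the element [k = th * u] gives [k - s k = (th + s th) * u = u]. *)
  - move=> u /eqP; rewrite addrC addr_eq0 => /eqP su; exists (th * u).
    by rewrite rmorphM su mulrN opprK -mulrDl thE mul1r.
  - by move=> x; exists (th * f x x); rewrite rmorphM -fs -mulrDl thE mul1r.
case=> qZ ql qnd; exists idfun, id; split=> //=.
- by move=> x y; rewrite /polar [y + x]addrC; ring.
- by move=> x y; rewrite /polar; ring.
- by move=> u ->; exists 0; rewrite subrr.
- by move=> x; exists (q x).
- move=> x qx; rewrite /polar -mulr2n -scaler_nat qZ qx; ring.
Qed.

End Form.

(** * Orthogonality and totally singular subspaces *)

Lemma span_pred (K : fieldType) (vT : vectType K) (P : vT -> Prop) (X : seq vT) :
  P 0 -> (forall a x y, P x -> P y -> P (a *: x + y)) ->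
  (forall x, x \in X -> P x) -> forall v, v \in <<X>>%VS -> P v.
Proof.
move=> P0 Plin PX; have [W WP] := vspace_of_pred P0 Plin.
have /subvP sXW : (<<X>> <= W)%VS by apply/span_subvP=> x /PX /WP.
by move=> v /sXW /WP.
Qed.

Lemma dim_rV (K : fieldType) m : \dim {: 'rV[K]_m} = m.
Proof. by rewrite dimvf; apply: mul1n. Qed.

Section Laws.
Variables (K : fieldType) (vT : vectType K) (F : pform vT).
Variables (s : {rmorphism K -> K}) (T : K -> K).
Hypothesis HL : form_laws F s T.
Local Notation f := (bil F).
Local Notation N := (pnorm F).
Implicit Types (x y z : vT) (A B U W : {vspace vT}).

Lemma bilDl x y z : f (x + y) z = f x z + f y z.
Proof. by have := bil_linear HL 1 x y z; rewrite scale1r mul1r. Qed.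

Lemma bil0l z : f 0 z = 0.
Proof. by apply: (addrI (f 0 z)); rewrite -bilDl !addr0. Qed.

Lemma bilZl a x z : f (a *: x) z = a * f x z.
Proof. by have := bil_linear HL a x 0 z; rewrite addr0 bil0l addr0. Qed.

Lemma bilNl x z : f (- x) z = - f x z.
Proof. by rewrite -scaleN1r bilZl mulN1r. Qed.

Lemma bilDr x y z : f z (x + y) = f z x + f z y.
Proof. by rewrite (bil_conj HL) bilDl rmorphD -!(bil_conj HL). Qed.

Lemma bil0r z : f z 0 = 0.
Proof. by rewrite (bil_conj HL) bil0l rmorph0. Qed.

Lemma bilZr a x z : f z (a *: x) = s a * f z x.
Proof. by rewrite (bil_conj HL) bilZl rmorphM -(bil_conj HL). Qed.

Lemma bilNr x z : f z (- x) = - f z x.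
Proof. by rewrite (bil_conj HL) bilNl rmorphN -(bil_conj HL). Qed.

Definition bilE := (bilDl, bilDr, bilNl, bilNr, bilZl, bilZr, bil0l, bil0r).

Lemma bil_sym0 x y : f x y = 0 -> f y x = 0.
Proof. by move=> h; rewrite (bil_conj HL) h rmorph0. Qed.

Lemma trace0 : T 0 = 0.
Proof. by apply: (addrI (T 0)); rewrite -(traceD HL) !addr0. Qed.

Lemma pnorm0 : N 0 = 0.
Proof. by rewrite -(scale0r 0) (pnormZ HL) !mul0r. Qed.

Lemma pnorm_scale0 a x : N x = 0 -> N (a *: x) = 0.
Proof. by rewrite (pnormZ HL) => ->; rewrite mulr0. Qed.

Lemma pnorm_add0 x y : N x = 0 -> N y = 0 -> f x y = 0 -> N (x + y) = 0.
Proof. by rewrite (pnormD HL) => -> -> ->; rewrite trace0 !addr0. Qed.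

Lemma tot_singP U :
  tot_sing F U <->
  (forall x, x \in U -> N x = 0) /\ (forall x y, x \in U -> y \in U -> f x y = 0).
Proof. by rewrite /tot_sing; split=> -[h1 h2]; split=> // x /h1; rewrite singE. Qed.

Lemma tot_singS U W : (U <= W)%VS -> tot_sing F W -> tot_sing F U.
Proof.
by move=> /subvP UW [h1 h2]; split=> [x /UW /h1|x y /UW xW /UW]; last exact: h2.
Qed.

Lemma tot_sing_line x : N x = 0 -> tot_sing F <[x]>%VS.
Proof.
move=> Nx; apply/tot_singP; split=> [_ /vlineP[a ->]|_ _ /vlineP[a ->] /vlineP[b ->]].
  exact: pnorm_scale0.
by rewrite !bilE (pnorm_bil HL Nx) !mulr0.
Qed.

Lemma tot_sing_add A B : tot_sing F A -> tot_sing F B -> orthv F A B ->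
  tot_sing F (A + B)%VS.
Proof.
move=> /tot_singP[A1 A2] /tot_singP[B1 B2] AB; apply/tot_singP; split.
  by move=> _ /memv_addP[a aA [b bB ->]]; apply: pnorm_add0; auto.
move=> _ _ /memv_addP[a aA [b bB ->]] /memv_addP[a' aA' [b' bB' ->]].
by rewrite !bilE (A2 a a') // (B2 b b') // (AB a b') // (bil_sym0 (AB _ _ aA' bB)) !addr0.
Qed.

Lemma orthv_basisr U X u : (forall c, c \in X -> f u c = 0) ->
  U = <<X>>%VS -> forall c, c \in U -> f u c = 0.
Proof.
move=> h -> ; apply: span_pred => [|a x y hx hy|//]; first exact: bil0r.
by rewrite !bilE hx hy mulr0 addr0.
Qed.

Lemma row_linear B : linear (fun u => \row_(j < \dim B) f u (vbasis B)`_j).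
Proof. by move=> a x y; apply/rowP=> j; rewrite !mxE !bilE. Qed.

(** Rank-nullity for the map sending [u] to its products with a basis of [B]: on [U] its kernel lies
    in [W], and its image in a space of dimension [\dim B]. *)
Lemma dim_orth_le U B W :
  (forall u, u \in U -> (forall b, b \in B -> f u b = 0) -> u \in W) ->
  (\dim U <= \dim W + \dim B)%N.
Proof.
move=> h; have [phi phiE] := linear_lfun (@row_linear B).
rewrite -(limg_ker_dim phi U) leq_add //.
  apply: dimvS; apply/subvP=> u /memv_capP[uU]; rewrite memv_ker phiE => /eqP/rowP u0.
  apply: h => //; apply: (@orthv_basisr _ (vbasis B)).
    by move=> c /(nthP 0)[i]; rewrite size_tuple => ib <-; have := u0 (Ordinal ib); rewrite !mxE.
  by rewrite (span_basis (vbasisP B)).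
by apply: leq_trans (dimvS (subvf _)) _; rewrite dim_rV.
Qed.

Definition nondeg_pair A B :=
  forall a, a \in A -> (forall b, b \in B -> f a b = 0) -> a = 0.

Lemma nondeg_pair_dim A B : nondeg_pair A B -> (\dim A <= \dim B)%N.
Proof.
move=> nAB; have := @dim_orth_le A B 0%VS; rewrite dimv0 add0n; apply.
by move=> a aA /(nAB _ aA) ->; rewrite mem0v.
Qed.

(** Pairing with a basis of [B] is injective on [A], and [\dim B <= \dim A] makes it onto. *)
Lemma nondeg_pair_riesz A B (phi : vT -> K) :
  nondeg_pair A B -> nondeg_pair B A ->
  (forall a x y, phi (a *: x + y) = a * phi x + phi y) ->
  exists2 a, a \in A & forall b, b \in B -> f b a = phi b.
Proof.
move=> nAB nBA phil; have [g gE] := linear_lfun (@row_linear B).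
have /eqP gA : (g @: A == fullv)%VS.
  rewrite eqEdim subvf /= dim_rV limg_dim_eq ?(nondeg_pair_dim nBA) //.
  apply/eqP; rewrite -subv0; apply/subvP=> a /memv_capP[aA].
  rewrite memv_ker gE => /eqP/rowP a0; rewrite memv0; apply/eqP/nAB=> //.
  apply: (@orthv_basisr _ (vbasis B)).
    by move=> c /(nthP 0)[i]; rewrite size_tuple => ib <-; have := a0 (Ordinal ib); rewrite !mxE.
  by rewrite (span_basis (vbasisP B)).
(* The target values carry [s] because [f a b], not [f b a], is linear in [a]; conjugating back
   yields [phi]. *)
have := memvf (\row_(j < \dim B) s (phi (vbasis B)`_j)); rewrite -gA.
move=> /memv_imgP[a aA]; rewrite gE => /rowP aE; exists a => // b.
have phi0 : phi 0 = 0.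
  by have := phil (-1) 0 0; rewrite scaler0 addr0 mulN1r addNr.
rewrite -{1}(span_basis (vbasisP B)); apply: (@span_pred _ _ (fun b => f b a = phi b)) => [|c x y xE yE|x].
- by rewrite bil0l phi0.
- by rewrite !bilE phil xE yE.
move=> /(nthP 0)[i]; rewrite size_tuple => ib <-; have := aE (Ordinal ib); rewrite !mxE /= => sE.
by rewrite (bil_conj HL) -sE (conjK HL).
Qed.

(** Otherwise [<[x]> + A] would be totally singular of dimension larger than the Witt index. *)
Lemma witt_maximal n A x : witt_index F n -> tot_sing F A -> \dim A = n ->
  N x = 0 -> (forall a, a \in A -> f x a = 0) -> x \in A.
Proof.
move=> [_ wn] sA dA Nx xA.
have /wn : tot_sing F (<[x]> + A)%VS.
  apply: tot_sing_add => //; first exact: tot_sing_line.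
  by move=> _ a /vlineP[c ->] aA; rewrite bilZl xA // mulr0.
rewrite -dA => le; have /eqP-> : A == (<[x]> + A)%VS by rewrite eqEdim addvSr.
by apply: (subvP (addvSl _ _)); exact: memv_line.
Qed.

(** A vector of [U] orthogonal to a complement of the intersection in [A] is orthogonal to all of
    [A], hence lies in [A]. Thus [U] exceeds the intersection by at most the dimension of that
    complement. *)
Lemma maximal_dim A U : tot_sing F A -> tot_sing F U ->
  (forall x, N x = 0 -> (forall a, a \in A -> f x a = 0) -> x \in A) ->
  (\dim U <= \dim A)%N.
Proof.
move=> _ /tot_singP[sU oU] maxA.
rewrite -(dimv_cap_compl A U); apply: dim_orth_le => u uU h.
rewrite memv_cap uU andbT; apply: maxA; first exact: sU.
move=> a; rewrite -(addv_diff_cap A U) => /memv_addP[b bD [c /memv_capP[_ cU] ->]].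
by rewrite bilDr h // oU // addr0.
Qed.

End Laws.

(** * Singular vectors over a hyperbolic subspace *)

Section Hyperbolic.
Variables (K : fieldType) (vT : vectType K) (F : pform vT).
Variables (s : {rmorphism K -> K}) (T : K -> K).
Hypothesis HL : form_laws F s T.
Local Notation f := (bil F).
Local Notation N := (pnorm F).
Let fE := bilE HL.

Lemma nondeg_pair_two A B b b' k k' : nondeg_pair F A B -> nondeg_pair F B A ->
  b \in B -> b' \in B -> free [:: b; b'] ->
  exists a, [/\ a \in A, f a b = k & f a b' = k'].
Proof.
move=> nAB nBA bB bB' fr.
have [phi [phil phib phib']] := basis_functional (s k) (s k') fr.
have [a aA aE] := nondeg_pair_riesz HL nAB nBA phil.
by exists a; split; rewrite // (bil_conj HL) aE // ?phib ?phib' (conjK HL).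
Qed.

Lemma exists_orth B a : (2 <= \dim B)%N ->
  exists w, [/\ w \in B, w != 0 & f a w = 0].
Proof.
move=> dB; have [b [b' [bB bB' fr]]] := exists_free2 dB.
have b0 : b != 0 by apply: (free_not0 fr); rewrite !inE eqxx.
have [ab|ab] := eqVneq (f a b) 0; first by exists b.
exists (b' - s (f a b' / f a b) *: b); split.
- by rewrite memvB ?memvZ.
- apply/eqP=> /(canRL (subrK _)); rewrite add0r => b'E.
  move: fr; rewrite -(@perm_free _ _ [:: b'; b]) ?(perm_catC [:: b'] [:: b]) //.
  by rewrite free_cons span_seq1 b'E memvZ ?memv_line.
- by rewrite !fE (conjK HL) divfK ?subrr.
Qed.

Variables A B : {vspace vT}.
Hypothesis sA : tot_sing F A.
Hypothesis sB : tot_sing F B.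
Hypothesis nAB : nondeg_pair F A B.
Hypothesis nBA : nondeg_pair F B A.
Hypothesis dB : (2 <= \dim B)%N.

Let oA a a' : a \in A -> a' \in A -> f a a' = 0.
Proof. by case: sA => _; apply. Qed.
Let oB b b' : b \in B -> b' \in B -> f b b' = 0.
Proof. by case: sB => _; apply. Qed.
Let zA a : a \in A -> N a = 0.
Proof. by case: sA => h _ /h; rewrite singE. Qed.
Let zB b : b \in B -> N b = 0.
Proof. by case: sB => h _ /h; rewrite singE. Qed.

Lemma pnorm_hyp a b : a \in A -> b \in B -> N (a + b) = T (f a b).
Proof. by move=> aA bB; rewrite (pnormD HL) zA // zB // !add0r. Qed.

(** Provides a correction: replacing [a], [b] by [a + a'], [b + b'] changes [f a b] by exactly
    [u]. *)
Lemma exists_orth_pair a b u : a \in A -> b \in B -> f a b != 0 ->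
  exists a' b', [/\ a' \in A, b' \in B, f a' b = 0, f a b' = 0 & f a' b' = u].
Proof.
move=> aA bB ab; have [b' [bB' b0' ab']] := exists_orth a dB.
have fr : free [:: b; b'].
  apply: free2P => // c bE; case/eqP: ab.
  by rewrite bE (bilZr HL) // ab' mulr0.
have [a' [aA' ab0 ab1]] := nondeg_pair_two 0 u nAB nBA bB bB' fr.
by exists a', b'.
Qed.

(** The component in [A] represents the functional [f _ v] on [B], and the component in [B]
    represents it on [A]. *)
Lemma hyp_proj v : exists a b, [/\ a \in A, b \in B &
  (forall x, x \in A -> f (v - (a + b)) x = 0) /\
  (forall x, x \in B -> f (v - (a + b)) x = 0)].
Proof.
have lin a x y : f (a *: x + y) v = a * f x v + f y v by rewrite (bil_linear HL).
have [a aA aE] := nondeg_pair_riesz HL nAB nBA lin.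
have [b bB bE'] := nondeg_pair_riesz HL nBA nAB lin.
exists a, b; split=> //; split=> x xU; apply: (bil_sym0 HL); rewrite !fE.
  by rewrite (bE' _ xU) (oA xU aA) add0r subrr.
by rewrite (aE _ xU) (oB xU bB) addr0 subrr.
Qed.

(** The orthogonal complement of [A + B], that is, the part D. *)
Definition hyp_orth c := (forall a, a \in A -> f c a = 0) /\ (forall b, b \in B -> f c b = 0).

Lemma hyp_orthZ k c : hyp_orth c -> hyp_orth (k *: c).
Proof.
by move=> [h1 h2]; split=> x xU; rewrite (bilZl HL); [rewrite h1 | rewrite h2]; rewrite ?mulr0.
Qed.

Hypothesis anis : forall c, hyp_orth c -> N c = 0 -> c = 0.

Lemma pnorm_hyp_orth a b c : a \in A -> b \in B -> hyp_orth c ->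
  N (a + b + c) = T (f a b) + N c.
Proof.
move=> aA bB [cA cB]; rewrite (pnormD HL) pnorm_hyp //.
by rewrite (bilDl HL) // (bil_sym0 HL (cA _ aA)) (bil_sym0 HL (cB _ bB)) addr0 (trace0 HL) // addr0.
Qed.

Variable S : vT -> Prop.
Hypothesis SN : forall v, S v -> N v = 0.
Hypothesis SZ : forall k v, S v -> S (k *: v).
Hypothesis SD : forall v w, S v -> S w -> f v w = 0 -> S (v + w).
Hypothesis SA : forall a, a \in A -> S a.
Hypothesis SB : forall b, b \in B -> S b.

(** If [f a b] is not zero, [a + b] is split into two orthogonal vectors, each the sum of an element
    of [A] and an element of [B] orthogonal to it. *)
Lemma sub_hyp a b : a \in A -> b \in B -> T (f a b) = 0 -> S (a + b).
Proof.
move=> aA bB Tab; have [ab|ab] := eqVneq (f a b) 0; first by auto.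
have [k kE] := trace_eq0 HL Tab; set t := f a b in Tab ab kE.
(* The aim is [f a1 b = f a b1 = f a1 b1 = k]. The scalings by [k / t] contribute [k * k / t] to the
   last product, and [f a' b'] supplies the rest. Orthogonality of the two summands then reduces to
   [t = k - s k]. *)
have [a' [b' [aA' bB' ab' a'b a'b']]] := exists_orth_pair (k - k * k / t) aA bB ab.
pose a1 := (k / t) *: a + a'; pose b1 := s (k / t) *: b + b'.
have aA1 : a1 \in A by rewrite memvD ?memvZ.
have bB1 : b1 \in B by rewrite memvD ?memvZ.
have e1 : f a1 b = k by rewrite !fE ab' -/t addr0 divfK.
have e2 : f a b1 = k by rewrite !fE a'b -/t (conjK HL) addr0 divfK.
have e3 : f a1 b1 = k.
  by rewrite !fE a'b ab' a'b' -/t (conjK HL); field.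
clearbody a1 b1.
have -> : a + b = (a1 + (b - b1)) + ((a - a1) + b1).
  by rewrite addrACA [a1 + _]addrC !subrK.
have aA2 : a - a1 \in A by rewrite memvB.
have bB2 : b - b1 \in B by rewrite memvB.
apply: SD.
- by apply: SD; auto; rewrite !fE e1 e3 subrr.
- by apply: SD; auto; rewrite !fE e2 e3 subrr.
rewrite (bilDl HL) 2!(bilDr HL (a - a1) b1) (oA aA1 aA2) (oB bB2 bB1) e3.
rewrite (bil_conj HL (a - a1)) !fE e1 e2 e3 -/t kE !(rmorphD, rmorphN) (conjK HL); ring.
Qed.

(* The set [{(a, b) | f a b = t}] is connected under changing one of the two
   coordinates at a time, and each such change adds a singular vector of [A] or [B]
   orthogonal to the current vector. *)
Lemma move_same a b a' b' c : a \in A -> b \in B -> a' \in A -> b' \in B ->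
  hyp_orth c -> f a b != 0 -> f a b = f a' b' -> S (a + b + c) -> S (a' + b' + c).
Proof.
move=> aA bB aA' bB' [cA cB] t0 tE.
have moveB x y z : x \in A -> y \in B -> z \in B -> f x y = f x z ->
    S (x + y + c) -> S (x + z + c).
  move=> xU yU zU e Sv; have zyU : z - y \in B by rewrite memvB.
  have -> : x + z + c = (x + y + c) + (z - y).
    by rewrite [RHS]addrAC -[x + y + _]addrA [y + _]addrC subrK.
  apply: SD; auto; rewrite !(bilDl HL) // (oB yU zyU) cB // !fE e.
  by rewrite subrr !addr0.
have moveA x y z : x \in A -> y \in A -> z \in B -> f x z = f y z ->
    S (x + z + c) -> S (y + z + c).
  move=> xU yU zU e Sv; have yxU : y - x \in A by rewrite memvB.
  have -> : y + z + c = (x + z + c) + (y - x).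
    by rewrite [RHS]addrAC [x + z + _]addrAC [x + _]addrC subrK.
  apply: SD; auto; rewrite !(bilDl HL) // (oA xU yxU) cA // add0r addr0.
  by apply: (bil_sym0 HL); rewrite !fE e subrr.
have b0' : b' != 0.
  by apply: contraNneq t0 => b0'; rewrite tE b0' (bil0r HL).
move=> Sv.
(* The path is [(a, b)], [(a, b1)], [(a1, b1)], [(a1, b')], [(a', b')]. Independence of [b1] and
   [b'] is what allows a single [a1] to have product [f a b] with both. *)
have [b1 [bB1 ab1 fr]] : exists b1, [/\ b1 \in B, f a b1 = f a b & free [:: b1; b']].
  have [[k bk]|nb] := lem (exists k, b = k *: b'); last first.
    by exists b; split=> //; apply: free2P => // k bk; apply: nb; exists k.
  have [w [wB w0 aw]] := exists_orth a dB.
  have k0 : k != 0 by apply: contraNneq t0 => k0; rewrite bk k0 scale0r (bil0r HL).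
  exists (b + w); split; first by rewrite memvD.
    by rewrite (bilDr HL) // aw addr0.
  apply: free2P => // l /(canRL (addKr _)) wE.
  have wb : w = ((l - k) / k) *: b.
    by rewrite wE bk scalerA divfK // scalerBl addrC.
  move/eqP: aw; rewrite {1}wb (bilZr HL) // mulf_eq0 (negPf t0) orbF fmorph_eq0 => /eqP r0.
  by case/eqP: w0; rewrite wb r0 scale0r.
have [a1 [aA1 a1b1 a1b']] := nondeg_pair_two (f a b) (f a b) nAB nBA bB1 bB' fr.
have S1 := moveB _ _ _ aA bB bB1 (esym ab1) Sv.
have S2 := moveA _ _ _ aA aA1 bB1 (etrans ab1 (esym a1b1)) S1.
have S3 := moveB _ _ _ aA1 bB1 bB' (etrans a1b1 (esym a1b')) S2.
exact: moveA aA1 aA' bB' (etrans a1b' tE) S3.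
Qed.

(** For [c = 0] the target is a singular vector of [A + B]. Otherwise anisotropy makes [f a b]
    nonzero, and adding a singular [x + y] orthogonal to [a + b + c] brings the product to [f a' b']
    itself, where [move_same] applies. *)
Lemma move_hyp a b a' b' c : a \in A -> b \in B -> a' \in A -> b' \in B ->
  hyp_orth c -> T (f a b) = T (f a' b') -> S (a + b + c) -> S (a' + b' + c).
Proof.
move=> aA bB aA' bB' oc Te Sv.
have Nv := SN Sv; rewrite pnorm_hyp_orth // in Nv.
have [c0|c0] := eqVneq c 0.
  rewrite c0 (pnorm0 HL) // addr0 in Nv; rewrite c0 addr0.
  by apply: sub_hyp => //; rewrite -Te.
have Tn0 : T (f a b) != 0.
  apply: contraNneq c0 => T0; apply/eqP/anis => //.
  by rewrite T0 add0r in Nv.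
have t0 : f a b != 0 by apply: contraNneq Tn0 => ->; rewrite (trace0 HL).
have t0' : f a' b' != 0 by apply: contraNneq Tn0; rewrite Te => ->; rewrite (trace0 HL).
pose u := f a' b' - f a b.
have Tu : T u = 0.
  by apply: (addIr (T (f a b))); rewrite -(traceD HL) subrK add0r Te.
have [x [y [xA yB xb ay xy]]] := exists_orth_pair u aA bB t0.
have abE : f (a + x) (b + y) = f a' b'.
  by rewrite !fE xb ay xy addr0 add0r addrC subrK.
apply: (@move_same (a + x) (b + y)); rewrite ?memvD ?abE //.
have -> : a + x + (b + y) + c = a + b + c + (x + y) by rewrite [a + x + _]addrACA [LHS]addrAC.
apply: SD => //; first by apply: sub_hyp; rewrite ?xy.
case: (oc) => cA cB.
rewrite [f _ (x + y)](bilDr HL) // !(bilDl HL _ _ x) !(bilDl HL _ _ y) cA // cB //.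
by rewrite (oA aA xA) (oB bB yB) ay (bil_sym0 HL xb) !addr0.
Qed.

Lemma sub_sum c c' : hyp_orth c -> hyp_orth c' ->
  (exists a b, [/\ a \in A, b \in B & S (a + b + c)]) ->
  (exists a b, [/\ a \in A, b \in B & S (a + b + c')]) ->
  exists a b, [/\ a \in A, b \in B & S (a + b + (c + c'))].
Proof.
move=> oc oc' [a [b [aA bB Sv]]] [a' [b' [aA' bB' Sv']]].
have [b1 [b2 [bB1 bB2 fr]]] := exists_free2 dB.
(* The norms are preserved by [f a1 b1 = f a b] and [f a2 b2 = f a' b']. The remaining free values,
   [f a1 b2 = - f c c'] and [f a2 b1 = 0], make the two new vectors orthogonal. *)
have [a1 [aA1 a1b1 a1b2]] := nondeg_pair_two (f a b) (- f c c') nAB nBA bB1 bB2 fr.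
have [a2 [aA2 a2b1 a2b2]] := nondeg_pair_two 0 (f a' b') nAB nBA bB1 bB2 fr.
exists (a1 + a2), (b1 + b2); rewrite !memvD //; split=> //.
have -> : a1 + a2 + (b1 + b2) + (c + c') = (a1 + b1 + c) + (a2 + b2 + c').
  by rewrite [a1 + a2 + _]addrACA [LHS]addrACA.
apply: SD.
- by apply: (move_hyp aA bB) => //; rewrite a1b1.
- by apply: (move_hyp aA' bB') => //; rewrite a2b2.
case: oc oc' => [cA cB] [cA' cB'].
rewrite 2!(bilDl HL _ _ (_ + _)) !(bilDr HL) //.
rewrite (oA aA1 aA2) (oB bB1 bB2) a1b2 (bil_sym0 HL a2b1) (cA a2) // (cB b2) //.
by rewrite (bil_sym0 HL (cA' _ aA1)) (bil_sym0 HL (cB' _ bB1)) !(addr0, add0r) addNr.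
Qed.

Theorem singular_set_linear : exists U : {vspace vT},
  [/\ (A <= U)%VS, (B <= U)%VS & forall v, S v <-> v \in U /\ N v = 0].
Proof.
(* [P v] says that [v] is congruent modulo [A + B] to a vector of [S], so it depends only on the
   component of [v] in D. *)
pose P v := exists a b, [/\ a \in A, b \in B & S (a + b + v)].
have Padd a b v : a \in A -> b \in B -> P v -> P (a + b + v).
  move=> aA bB [x [y [xA yB Sv]]].
  exists (x - a), (y - b); rewrite !memvB //; split=> //.
  have -> // : x - a + (y - b) + (a + b + v) = x + y + v.
  by rewrite [LHS]addrA [x - a + _ + _]addrACA !subrK.
have Psub a b v : a \in A -> b \in B -> P (a + b + v) -> P v.
  move=> aA bB [x [y [xA yB Sv]]].
  exists (x + a), (y + b); rewrite !memvD //; split=> //.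
  by rewrite [x + a + _]addrACA -[x + y + _ + _]addrA.
have P0 : P 0 by exists 0, 0; rewrite !mem0v !addr0; split=> //; apply: SA; rewrite mem0v.
have [U UP] : exists U : {vspace vT}, forall v, v \in U <-> P v.
  apply: vspace_of_pred => // k x y Px Py.
  have [a [b [aA bB [cA cB]]]] := hyp_proj x; set c := x - (a + b) in cA cB.
  have [a' [b' [aA' bB' [cA' cB']]]] := hyp_proj y; set c' := y - (a' + b') in cA' cB'.
  have xE : x = a + b + c by rewrite addrC subrK.
  have yE : y = a' + b' + c' by rewrite addrC subrK.
  have oc : hyp_orth (k *: c) by apply: hyp_orthZ.
  rewrite xE in Px; rewrite yE in Py; move: Px Py => /(Psub _ _ _ aA bB) Pc /(Psub _ _ _ aA' bB') Pc'.
  have -> : k *: x + y = (k *: a + a') + (k *: b + b') + (k *: c + c').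
    by rewrite {1}xE {1}yE !scalerDr addrACA [k *: a + _ + _]addrACA.
  suff Pcc : P (k *: c + c') by apply: Padd; rewrite ?memvD ?memvZ.
  apply: (sub_sum oc (conj cA' cB')); last exact: Pc'.
  have [x1 [y1 [x1A y1B Sx]]] := Pc.
  by exists (k *: x1), (k *: y1); rewrite !memvZ // -!scalerDr; split=> //; apply: SZ.
exists U; split.
- apply/subvP=> a aA; apply/UP; rewrite -[a]addr0 -[a + 0]addr0.
  by apply: Padd; rewrite ?mem0v.
- apply/subvP=> b bB; apply/UP; rewrite -[b]add0r -[0 + b]addr0.
  by apply: Padd; rewrite ?mem0v.
move=> v; split=> [Sv|[/UP Pv Nv]].
  by split; [apply/UP; exists 0, 0; rewrite !mem0v !add0r | exact: SN].
have [a [b [aA bB oc]]] := hyp_proj v; set c := v - (a + b) in oc.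
have vE : v = a + b + c by rewrite addrC subrK.
rewrite vE in Pv Nv *; move: Pv => /(Psub _ _ _ aA bB)[x [y [xA yB Sv]]].
(* Both vectors are singular with the same component [c], so their hyperbolic parts have equal
   norm. *)
apply: (move_hyp xA yB) => //; apply: (addIr (N c)).
by rewrite -!pnorm_hyp_orth // Nv SN.
Qed.

End Hyperbolic.

(** * Nice subspaces and their linear spans *)

Section Points.
Variables (K : fieldType) (vT : vectType K) (F : pform vT).
Variables (s : {rmorphism K -> K}) (T : K -> K).
Hypothesis HL : form_laws F s T.
Local Notation f := (bil F).
Local Notation N := (pnorm F).
Implicit Types (X Y M : pset vT) (U W A B L p q : {vspace vT}).

Definition points U : pset vT := fun p => is_point F p /\ (p <= U)%VS.

Definition vectors X (v : vT) : Prop := v = 0 \/ X <[v]>%VS.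

Lemma is_point_line v : v != 0 -> N v = 0 -> is_point F <[v]>%VS.
Proof. by move=> v0 Nv; split; [rewrite dim_vline v0 | exact: tot_sing_line HL _ Nv]. Qed.

Lemma is_pointP p : is_point F p -> exists v, [/\ v != 0, p = <[v]>%VS & N v = 0].
Proof.
case=> dp [sp _]; have p0 : vpick p != 0 by rewrite vpick0 -dimv_eq0 dp.
exists (vpick p); split=> //; last by rewrite -singE; apply: sp; exact: memv_pick.
by apply/esym/eqP; rewrite eqEdim -memvE memv_pick dim_vline p0 dp.
Qed.

Lemma vectors_eqP X v : v != 0 -> vectors X v <-> X <[v]>%VS.
Proof. by move=> v0; split=> [[/eqP|//]|]; [rewrite (negPf v0) | right]. Qed.

Lemma vlineZ k (v : vT) : k != 0 -> <[k *: v]>%VS = <[v]>%VS.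
Proof.
move=> k0; apply/eqP; rewrite eqEsubv -!memvE memvZ ?memv_line //=.
by rewrite -{1}[v]scale1r -(mulVf k0) -scalerA memvZ ?memv_line.
Qed.

Lemma dim_add_points p q : is_point F p -> is_point F q -> p != q -> \dim (p + q)%VS = 2%N.
Proof.
move=> [dp _] [dq _] pq; rewrite dimv_disjoint_sum ?dp ?dq //.
apply/eqP; rewrite -dimv_eq0; have := dimvS (capvSl p q).
rewrite dp leq_eqVlt => /orP[/eqP d1|]; last by rewrite ltnS leqn0.
case/negP: pq; have /eqP <- : (p :&: q)%VS == p by rewrite eqEdim capvSl dp d1.
by rewrite eqEdim capvSr dq d1.
Qed.

Lemma add_points_line L p q : is_point F p -> is_point F q -> p != q ->
  is_line F L -> (p <= L)%VS -> (q <= L)%VS -> L = (p + q)%VS.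
Proof.
move=> pp pq npq [dL _] pL qL; apply/esym/eqP.
by rewrite eqEdim subv_add pL qL dim_add_points // dL.
Qed.

Lemma psubspace_points U : psubspace F (points U).
Proof.
split=> [p [] //|L lL [p [q [npq [pp pU] [pq qU] pL qL]]] r pr rL].
split=> //; apply: subv_trans rL _.
by rewrite (add_points_line pp pq npq lL pL qL) subv_add pU.
Qed.

Lemma singular_points U : tot_sing F U -> singular_subspace F (points U).
Proof.
move=> sU; split=> [|p q [pp pU] [pq qU] npq]; first exact: psubspace_points.
exists (p + q)%VS; rewrite addvSl addvSr; split=> //; split; first exact: dim_add_points.
by apply: tot_singS sU; rewrite subv_add pU.
Qed.

Section Subspace.
Variable X : pset vT.
Hypothesis subX : psubspace F X.

Lemma vectors_pnorm v : vectors X v -> N v = 0.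
Proof.
case=> [->|Xv]; first exact: pnorm0 HL.
by rewrite -singE; case: subX => /(_ _ Xv)[_ [h _]] _; apply/h/memv_line.
Qed.

Lemma vectorsZ k v : vectors X v -> vectors X (k *: v).
Proof.
case=> [->|Xv]; first by left; rewrite scaler0.
have [->|k0] := eqVneq k 0; first by left; rewrite scale0r.
by right; rewrite vlineZ.
Qed.

(** Unless [v] and [w] are proportional or their sum vanishes, they span a line meeting [X] in two
    points, and [v + w] spans a point of that line. *)
Lemma vectorsD v w : vectors X v -> vectors X w -> f v w = 0 -> vectors X (v + w).
Proof.
move=> Xv Xw vw; have Nv := vectors_pnorm Xv; have Nw := vectors_pnorm Xw.
have [->|v0] := eqVneq v 0; first by rewrite add0r.
have [->|w0] := eqVneq w 0; first by rewrite addr0.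
have [/eqP|npq] := eqVneq <[v]>%VS <[w]>%VS.
  rewrite eqEsubv -!memvE => /andP[/vlineP[k ->] _].
  by rewrite -{2}[w]scale1r -scalerDl; apply: vectorsZ.
have [vw0|vw0] := eqVneq (v + w) 0; first by left.
move: Xv Xw; rewrite !vectors_eqP // => Xv Xw.
have Nvw : N (v + w) = 0 by apply: (pnorm_add0 HL).
have pv := is_point_line v0 Nv; have pw := is_point_line w0 Nw.
case: subX => _ /(_ (<[v]> + <[w]>)%VS); apply.
- split; first exact: dim_add_points.
  apply: (tot_sing_add HL); [exact: tot_sing_line HL _ Nv | exact: tot_sing_line HL _ Nw|].
  by move=> _ _ /vlineP[a ->] /vlineP[b ->]; rewrite !(bilE HL) vw !mulr0.
- by exists <[v]>%VS, <[w]>%VS; rewrite addvSl addvSr.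
- exact: is_point_line.
by rewrite -memvE memv_add ?memv_line.
Qed.

Lemma points_of_vectors U : (forall v, vectors X v <-> v \in U /\ N v = 0) ->
  pseteq X (points U).
Proof.
move=> UX p; split=> [Xp|[pp pU]].
  have pp : is_point F p by case: subX => /(_ _ Xp).
  have [v [v0 pE Nv]] := is_pointP pp; split=> //; rewrite pE -memvE.
  by rewrite pE in Xp; move/(vectors_eqP _ v0): Xp => /UX[].
have [v [v0 pE Nv]] := is_pointP pp; rewrite pE in pU *.
by apply/(vectors_eqP _ v0)/UX; rewrite memvE.
Qed.

End Subspace.

Lemma singular_orth X v w : singular_subspace F X -> vectors X v -> vectors X w -> f v w = 0.
Proof.
move=> [subX colX] Xv Xw.
have [->|v0] := eqVneq v 0; first by rewrite (bil0l HL).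
have [->|w0] := eqVneq w 0; first by rewrite (bil0r HL).
have [/eqP|npq] := eqVneq <[v]>%VS <[w]>%VS.
  rewrite eqEsubv -!memvE => /andP[/vlineP[k ->] _].
  by rewrite (bilZl HL) (pnorm_bil HL (vectors_pnorm subX Xw)) mulr0.
move: Xv Xw; rewrite !vectors_eqP // => Xv Xw.
have [L [[_ [_ oL]]]] := colX _ _ Xv Xw npq.
by rewrite -!memvE; exact: oL.
Qed.

Lemma sub_points_vector U W v : psub (points U) (points W) -> N v = 0 -> v \in U -> v \in W.
Proof.
move=> UW Nv vU; have [->|v0] := eqVneq v 0; first exact: mem0v.
have [] : points W <[v]>%VS by apply: UW; split; [exact: is_point_line | rewrite -memvE].
by rewrite -memvE.
Qed.

Variable n : nat.
Hypothesis wn : witt_index F n.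

(** The vectors of [M] are pairwise orthogonal, hence form a subspace. A singular vector orthogonal
    to it could be adjoined, so it already belongs to it, and [maximal_dim] gives the dimension. *)
Lemma max_singular_vspace M : max_singular F M ->
  exists A, [/\ tot_sing F A, \dim A = n & forall v, v \in A <-> vectors M v].
Proof.
move=> [sM maxM]; have [subM colM] := sM.
have [A AM] : exists A, forall v, v \in A <-> vectors M v.
  apply: vspace_of_pred => [|k x y Mx My]; first by left.
  have Mkx := vectorsZ k Mx.
  by apply: vectorsD => //; apply: singular_orth sM Mkx My.
have sA : tot_sing F A.
  apply/tot_singP; split=> [x /AM /(vectors_pnorm subM) //|x y /AM Mx /AM My].
  exact: singular_orth sM Mx My.
have maxA x : N x = 0 -> (forall a, a \in A -> f x a = 0) -> x \in A.
  move=> Nx xA; have [->|x0] := eqVneq x 0; first exact: mem0v.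
  have sW : tot_sing F (<[x]> + A)%VS.
    apply: (tot_sing_add HL) => //; first exact: tot_sing_line HL _ Nx.
    by move=> _ a /vlineP[c ->] aA; rewrite (bilZl HL) xA // mulr0.
  apply/AM; right; apply: (maxM _ (singular_points sW)).
    move=> p Mp; have pp : is_point F p by case: subM => /(_ _ Mp).
    split=> //; have [v [v0 pE _]] := is_pointP pp.
    apply: subv_trans (addvSr _ _); rewrite pE -memvE; apply/AM; right.
    by rewrite -pE.
  by split; [exact: is_point_line | exact: addvSl].
exists A; split=> //; case: wn => [[U [sU dU]] lewn].
by apply/eqP; rewrite eqn_leq lewn // -dU (maximal_dim HL).
Qed.

Lemma max_singular_points A : tot_sing F A -> \dim A = n -> max_singular F (points A).
Proof.
move=> sA dA; split=> [|Y sY AY p Yp]; first exact: singular_points.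
have pp : is_point F p by case: sY => -[/(_ _ Yp)].
split=> //; have [v [v0 pE Nv]] := is_pointP pp; rewrite pE -memvE.
apply: (witt_maximal HL wn sA dA Nv) => a aA.
apply: (singular_orth sY); first by right; rewrite -pE.
have [->|a0] := eqVneq a 0; first by left.
right; apply: AY; split; last by rewrite -memvE.
apply: is_point_line => //.
by case/(tot_singP F): sA => h _; apply: h.
Qed.

(** The linear counterpart of [nice]: maximality of [A] and [B] is expressed by their dimension, the
    Witt index. *)
Definition nice_vspace U := exists A B,
  [/\ tot_sing F A, tot_sing F B, \dim A = n & \dim B = n] /\
  [/\ (A :&: B = 0)%VS, (A <= U)%VS & (B <= U)%VS].

Lemma nice_vspaceS U W : (U <= W)%VS -> nice_vspace U -> nice_vspace W.
Proof.
move=> UW [A [B [h [AB AU BU]]]]; exists A, B; split=> //.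
by split=> //; [exact: subv_trans AU UW | exact: subv_trans BU UW].
Qed.

Lemma nice_points U : nice_vspace U -> nice F (points U).
Proof.
move=> [A [B [[sA sB dA dB] [AB AU BU]]]]; split; first exact: psubspace_points.
exists (points A), (points B); split; try exact: max_singular_points.
- by move=> p [pp pA]; split=> //; exact: subv_trans pA AU.
- by move=> p [pp pB]; split=> //; exact: subv_trans pB BU.
move=> p [[dp _] pA] [_ pB]; have : (p <= A :&: B)%VS by rewrite subv_cap pA.
by rewrite AB subv0 -dimv_eq0 dp.
Qed.

Lemma nondeg_pair_max A B : tot_sing F A -> tot_sing F B -> \dim B = n ->
  (A :&: B = 0)%VS -> nondeg_pair F A B.
Proof.
move=> /tot_singP[sA _] sB dB AB a aA ab.
apply/eqP; rewrite -memv0 -AB memv_cap aA /=.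
by have := witt_maximal HL wn sB dB (sA _ aA) ab.
Qed.

Hypothesis n2 : (2 <= n)%N.

(** [U] is spanned by its singular vectors: a component [c] orthogonal to [A + B] becomes singular
    after adding a vector of [A + B] of norm [- N c]. *)
Lemma nice_span U W : nice_vspace U -> psub (points U) (points W) -> (U <= W)%VS.
Proof.
move=> [A [B [[sA sB dA dB] [AB /subvP AU /subvP BU]]]] UW.
have nAB := nondeg_pair_max sA sB dB AB.
have nBA : nondeg_pair F B A by apply: nondeg_pair_max => //; rewrite capvC.
have dB2 : (2 <= \dim B)%N by rewrite dB.
have AW a : a \in A -> a \in W.
  by move=> aA; apply: (sub_points_vector UW); [case/(tot_singP F): sA => h _; apply: h | exact: AU].
have BW b : b \in B -> b \in W.
  by move=> bB; apply: (sub_points_vector UW); [case/(tot_singP F): sB => h _; apply: h | exact: BU].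
apply/subvP=> u uU; have [a [b [aA bB oc]]] := hyp_proj HL sA sB nAB nBA u.
set c := u - (a + b) in oc.
have cU : c \in U by apply: memvB => //; apply: memvD; [exact: AU | exact: BU].
have uE : u = a + b + c by rewrite addrC subrK.
clearbody c; have [t tE] := trace_onto HL c.
have [b1 [b2 [bB1 bB2 fr]]] := exists_free2 dB2.
have [a1 [aA1 a1b1 _]] := nondeg_pair_two HL (- t) 0 nAB nBA bB1 bB2 fr.
have cW : a1 + b1 + c \in W.
  apply: (sub_points_vector UW).
    rewrite (pnorm_hyp_orth HL sA sB) // a1b1 -tE -(traceD HL) addNr.
    exact: trace0 HL.
  by do 2?[apply: memvD => //]; [exact: AU | exact: BU].
have -> : u = a + b + (a1 + b1 + c - (a1 + b1)).
  by rewrite [a1 + b1 + c]addrC addrK.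
by apply: memvD; [|apply: memvB => //]; apply: memvD; auto.
Qed.

Lemma nice_vspace_of X : nice F X -> exists2 U, nice_vspace U & pseteq X (points U).
Proof.
move=> [subX [M1 [M2 [/max_singular_vspace[A [sA dA AM]] /max_singular_vspace[B [sB dB BM]] MX1 MX2 M12]]]].
have AB : (A :&: B = 0)%VS.
  apply/eqP; rewrite -subv0; apply/subvP=> v /memv_capP[/AM Av /BM Bv].
  rewrite memv0; apply/negP=> /negP v0.
  by move: Av Bv; rewrite !vectors_eqP //; exact: M12.
have nAB := nondeg_pair_max sA sB dB AB.
have nBA : nondeg_pair F B A by apply: nondeg_pair_max => //; rewrite capvC.
have dB2 : (2 <= \dim B)%N by rewrite dB.
(* A singular vector orthogonal to both [A] and [B] lies in both by maximality. *)
have anis c : hyp_orth F A B c -> N c = 0 -> c = 0.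
  move=> [cA cB] Nc; apply/eqP; rewrite -memv0 -AB memv_cap.
  by rewrite (witt_maximal HL wn sA) // (witt_maximal HL wn sB).
have AX a : a \in A -> vectors X a by move=> /AM[->|/MX1]; [left | right].
have BX b : b \in B -> vectors X b by move=> /BM[->|/MX2]; [left | right].
have [U [AU BU UX]] := singular_set_linear HL sA sB nAB nBA dB2 anis
  (vectors_pnorm subX) (@vectorsZ X) (vectorsD subX) AX BX.
by exists U; [exists A, B | exact: points_of_vectors].
Qed.

End Points.

(** * Chains *)

Section Defect.
Variables (K : fieldType) (vT : vectType K) (F : pform vT).
Variables (s : {rmorphism K -> K}) (T : K -> K).
Hypothesis HL : form_laws F s T.
Local Notation f := (bil F).
Local Notation N := (pnorm F).

Lemma tot_sing_span (X : seq vT) : (forall x, x \in X -> N x = 0) ->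
  (forall x y, x \in X -> y \in X -> f x y = 0) -> tot_sing F <<X>>%VS.
Proof.
elim: X => [|x X IH] sX oX.
  rewrite span_nil; apply/tot_singP; split=> [x|x y]; rewrite memv0 => /eqP->.
    exact: pnorm0 HL.
  by rewrite (bil0l HL).
rewrite span_cons; apply: (tot_sing_add HL).
- by apply: (tot_sing_line HL); apply: sX; rewrite inE eqxx.
- by apply: IH => [y yX|y z yX zX]; [apply: sX | apply: oX]; rewrite inE ?yX ?zX orbT.
move=> _ z /vlineP[k ->] zX; rewrite (bilZl HL) (orthv_basisr HL (X := X) _ erefl zX) ?mulr0 //.
by move=> y yX; apply: oX; rewrite inE ?eqxx ?yX ?orbT.
Qed.

Lemma hyperbolic_dim (H : {vspace vT}) : hyperbolic_plane F H -> \dim H = 2%N.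
Proof.
move=> [e [g [se sg eg ->]]].
have g0 : g != 0 by apply/eqP=> g0; move/eqP: eg; rewrite g0 (bil0r HL) eq_sym oner_eq0.
rewrite singE in sg.
have fr : free [:: e; g].
  apply: free2P => // c ec; move/eqP: eg.
  by rewrite ec (bilZl HL) (pnorm_bil HL sg) mulr0 eq_sym oner_eq0.
by rewrite (eqP fr).
Qed.

(** [A] and [B] are spanned by the first and the second vectors of the hyperbolic pairs. Each has
    dimension at most [n], while their sum contains all the planes, which forces equality and
    trivial intersection. *)
Lemma anisotropic_defect_split n d : anisotropic_defect F n d ->
  \dim {:vT} = (n + n + d)%N /\ nice_vspace F n fullv.
Proof.
move=> [Vs [V0 [hVs [oVs [_ [_ [VE [dV dV0]]]]]]]].
have dVs : (\sum_(i < n) \dim (Vs i) = n + n)%N.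
  rewrite (eq_bigr (fun=> 2%N)) => [|i _]; last exact: hyperbolic_dim.
  by rewrite sum_nat_const card_ord muln2 addnn.
have dim_V : \dim {:vT} = (n + n + d)%N.
  by move/directvP: dV; rewrite /= dVs VE dV0.
split=> //.
have [eg egP] := choice (fun i => let: ex_intro e (ex_intro g h) := hVs i in
  ex_intro (fun p : vT * vT => [/\ sing F p.1, sing F p.2, f p.1 p.2 = 1 & Vs i = <<[:: p.1; p.2]>>%VS])
    (e, g) h).
have mem1 i : (eg i).1 \in Vs i.
  by have [_ _ _ ->] := egP i; apply: memv_span; rewrite inE eqxx.
have mem2 i : (eg i).2 \in Vs i.
  by have [_ _ _ ->] := egP i; apply: memv_span; rewrite !inE eqxx orbT.
have tsing (c : 'I_n -> vT) : (forall i, N (c i) = 0) -> (forall i, c i \in Vs i) ->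
    tot_sing F <<codom c>>%VS.
  move=> Nc cV; apply: tot_sing_span => [_ /codomP[i ->] //|_ _ /codomP[i ->] /codomP[j ->]].
  have [->|ij] := eqVneq i j; first exact: (pnorm_bil HL (Nc j)).
  exact: oVs ij _ _ (cV i) (cV j).
pose A := <<codom (fun i => (eg i).1)>>%VS; pose B := <<codom (fun i => (eg i).2)>>%VS.
have sA : tot_sing F A.
  by apply: tsing => // i; rewrite -singE; have [] := egP i.
have sB : tot_sing F B.
  by apply: tsing => // i; rewrite -singE; have [] := egP i.
have dA : (\dim A <= n)%N by apply: leq_trans (dim_span _) _; rewrite size_codom card_ord.
have dB : (\dim B <= n)%N by apply: leq_trans (dim_span _) _; rewrite size_codom card_ord.
have VAB : (\sum_(i < n) Vs i <= A + B)%VS.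
  apply/subv_sumP=> i _; have [_ _ _ ->] := egP i.
  rewrite span_cons span_seq1 addvS // -memvE; apply: memv_span;
    exact: codom_f.
have dle : (n + n <= \dim (A + B))%N.
  apply: leq_trans (dimvS VAB).
  by rewrite -(leq_add2r d) -dim_V -VE -dV0 -dimv_sum_cap leq_addr.
have dcap := dimv_sum_cap A B.
have [dAn dBn dc] : [/\ \dim A = n, \dim B = n & \dim (A :&: B) = 0%N].
  have h1 : (n + n <= \dim A + \dim B)%N by rewrite -dcap (leq_trans dle) ?leq_addr.
  have dAn : \dim A = n.
    apply/eqP; rewrite eqn_leq dA -(leq_add2r n) (leq_trans h1) // leq_add2l //.
  have dBn : \dim B = n.
    apply/eqP; rewrite eqn_leq dB -(leq_add2l n) (leq_trans h1) // leq_add2r //.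
  split=> //; apply/eqP; rewrite -leqn0 -(leq_add2l (\dim (A + B))) dcap dAn dBn addn0 //.
exists A, B; split=> //; split; rewrite ?subvf //.
by apply/eqP; rewrite -dimv_eq0 dc.
Qed.

End Defect.

(** * Members of a chain classified by the dimensions of their spans *)

Section Chains.
Variables (K : fieldType) (vT : vectType K) (F : pform vT).
Variables (s : {rmorphism K -> K}) (T : K -> K).
Hypothesis HL : form_laws F s T.
Variables n d : nat.
Hypothesis wn : witt_index F n.
Hypothesis n2 : (2 <= n)%N.
Hypothesis dimV : \dim {:vT} = (n + n + d)%N.
Hypothesis nice_full : nice_vspace F n fullv.
Implicit Types (X Y : pset vT) (U W : {vspace vT}).

Lemma nice_dim U : nice_vspace F n U -> (n + n <= \dim U)%N.
Proof.
move=> [A [B [[_ _ dA dB] [AB AU BU]]]].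
have /dimvS : (A + B <= U)%VS by rewrite subv_add AU.
by rewrite dimv_disjoint_sum // dA dB.
Qed.

Lemma nice_dim_max U : (\dim U <= n + n + d)%N.
Proof. by rewrite -dimV dimvS ?subvf. Qed.

Lemma nice_min U : nice_vspace F n U ->
  exists W, [/\ nice_vspace F n W, (W <= U)%VS & \dim W = (n + n)%N].
Proof.
move=> [A [B [[sA sB dA dB] [AB AU BU]]]]; exists (A + B)%VS; split.
- by exists A, B; split=> //; split=> //; [exact: addvSl | exact: addvSr].
- by rewrite subv_add AU.
- by rewrite dimv_disjoint_sum // dA dB.
Qed.

Lemma psub_points U W : (U <= W)%VS -> psub (points F U) (points F W).
Proof. by move=> UW p [pp pU]; split=> //; exact: subv_trans pU UW. Qed.

Definition spans X U := nice_vspace F n U /\ pseteq X (points F U).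

Lemma spans_sub X Y U W : spans X U -> spans Y W -> psub X Y -> (U <= W)%VS.
Proof.
move=> [nU XU] [nW YW] XY; apply: (nice_span HL wn n2 nU) => p /XU /XY /YW //.
Qed.

Lemma spans_psub X Y U W : spans X U -> spans Y W -> (U <= W)%VS -> psub X Y.
Proof. by move=> [_ XU] [_ YW] UW p /XU /(psub_points UW) /YW. Qed.

Lemma chain_spans C X : chain F C -> C X -> exists U, spans X U.
Proof.
move=> [nC _] /nC /(nice_vspace_of HL wn n2)[U nU XU].
by exists U.
Qed.

Lemma spans_sub_total X Y U W : spans X U -> spans Y W ->
  psub X Y \/ psub Y X -> (\dim U <= \dim W)%N -> (U <= W)%VS.
Proof.
move=> XU YW [/(spans_sub XU YW) //|/(spans_sub YW XU) WU] le.
by have /eqP-> : W == U; rewrite ?subvv // eqEdim WU.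
Qed.

Lemma spans_dim_inj X Y U W : spans X U -> spans Y W ->
  psub X Y \/ psub Y X -> \dim U = \dim W -> pseteq X Y.
Proof.
move=> XU YW XY e p; have YX : psub Y X \/ psub X Y by case: XY; [right | left].
split; first by apply: (spans_psub XU YW); apply: (spans_sub_total XU YW XY); rewrite e.
by apply: (spans_psub YW XU); apply: (spans_sub_total YW XU YX); rewrite e.
Qed.

(** Spans have dimension between [n + n] and [n + n + d], and comparable members with spans of equal
    dimension coincide; [h] records the excess over [n + n]. *)
Lemma chain_dim_injection C m (X : 'I_m -> pset vT) : chain F C ->
  (forall i, C (X i)) -> (forall i j, i != j -> ~ pseteq (X i) (X j)) ->
  exists h : 'I_m -> 'I_d.+1, injective h /\
    forall i U, spans (X i) U -> \dim U = (n + n + h i)%N.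
Proof.
move=> cC CX dX; have [g gP] := choice (fun i => chain_spans cC (CX i)).
have hE i : (n + n + (inord (\dim (g i) - (n + n)) : 'I_d.+1))%N = \dim (g i).
  have le := nice_dim (proj1 (gP i)).
  by rewrite inordK ?subnKC // ltnS leq_subLR nice_dim_max.
exists (fun i => inord (\dim (g i) - (n + n))); split=> [i j hij|i U XU].
  apply/eqP; apply: contraPT (erefl (\dim (g i))) => /dX nij _; apply: nij.
  apply: (spans_dim_inj (gP i) (gP j)); first by case: cC => _; apply.
  by rewrite -[LHS]hE -[RHS]hE hij.
rewrite hE; apply/eqP; rewrite eqn_leq.
have XX : psub (X i) (X i) by [].
by rewrite (dimvS (spans_sub XU (gP i) XX)) (dimvS (spans_sub (gP i) XU XX)).
Qed.

Lemma chain_length_le C : chain F C -> chain_len_le C d.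
Proof.
move=> cC m X CX dX; have [h [hinj _]] := chain_dim_injection cC CX dX.
by have := leq_card h hinj; rewrite !card_ord.
Qed.

(** The [d.+1] members realise all [d.+1] possible dimensions, so a nice subspace comparable with
    all of them equals the one of its dimension. *)
Lemma chain_length_maximal C : chain F C -> chain_len_eq C d -> maximal_chain F C.
Proof.
move=> cC [X [CX dX _]]; split=> // Y nY YC.
have [h [hinj hE]] := chain_dim_injection cC CX dX.
have [U nU YU] := nice_vspace_of HL wn n2 nY; have sU : spans Y U by [].
have [h' hK h'K] := injF_bij hinj.
pose k : 'I_d.+1 := inord (\dim U - (n + n)).
have kE : (n + n + k)%N = \dim U.
  by rewrite inordK ?subnKC ?nice_dim // ltnS leq_subLR nice_dim_max.
exists (X (h' k)); split=> //.
have [W XW] := chain_spans cC (CX (h' k)).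
apply: (spans_dim_inj sU XW (YC _ (CX _))).
by rewrite (hE _ _ XW) h'K kE.
Qed.

Lemma exists_max_dim (P : {vspace vT} -> Prop) : (exists U, P U) ->
  exists2 U, P U & forall W, P W -> (\dim W <= \dim U)%N.
Proof.
move=> [U0 PU0]; pose Q k := `[< exists2 U, P U & \dim U = k >].
have exQ : exists k, Q k by exists (\dim U0); apply/asboolP; exists U0.
have bQ k : Q k -> (k <= n + n + d)%N by move=> /asboolP[U _ <-]; exact: nice_dim_max.
case: (ex_maxnP exQ bQ) => _ /asboolP[U PU <-] Umax; exists U => // W PW.
by apply: Umax; apply/asboolP; exists W.
Qed.

Lemma exists_min_dim (P : {vspace vT} -> Prop) : (exists U, P U) ->
  exists2 U, P U & forall W, P W -> (\dim U <= \dim W)%N.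
Proof.
move=> [U0 PU0]; pose Q k := `[< exists2 U, P U & \dim U = k >].
have exQ : exists k, Q k by exists (\dim U0); apply/asboolP; exists U0.
case: (ex_minnP exQ) => _ /asboolP[U PU <-] Umin; exists U => // W PW.
by apply: Umin; apply/asboolP; exists W.
Qed.

(** If dimension [l] were missed, a space [Z] of dimension [l] could be inserted between the spans
    below and above [l]; its points are comparable with every member, against maximality. *)
Lemma maximal_chain_dim C k : maximal_chain F C -> (k <= d)%N ->
  exists X U, [/\ C X, spans X U & \dim U = (n + n + k)%N].
Proof.
move=> [cC maxC] kd; apply: contrapT => noX; set l := (n + n + k)%N in noX.
pose P U := exists2 X, C X & spans X U.
have Pne U : P U -> \dim U != l.
  by move=> [X CX XU]; apply/eqP=> dU; apply: noX; exists X, U.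
have Ptot U W : P U -> P W -> (\dim U <= \dim W)%N -> (U <= W)%VS.
  move=> [X CX XU] [Y CY YW]; apply: (spans_sub_total XU YW).
  by case: cC => _; apply.
have [W1 [nW1 W1l W1P]] : exists W1, [/\ nice_vspace F n W1,
    (l <= \dim W1)%N & (forall U, P U -> (\dim U <= l)%N -> (U <= W1)%VS) /\
    (forall U, P U -> (l <= \dim U)%N -> (W1 <= U)%VS)].
  have [ex|nex] := lem (exists U, P U /\ (l <= \dim U)%N).
    have [W [PW lW] Wmin] := exists_min_dim ex; exists W; split=> //.
      by case: PW => X _ [].
    split=> U PU; first by move=> Ul; apply: Ptot => //; exact: leq_trans Ul lW.
    by move=> lU; apply: Ptot => //; apply: Wmin.
  (* With no span above [l], the whole space serves as upper bound. *)
  exists fullv; split; first by [].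
    by rewrite dimV leq_add2l.
  split=> U PU; first by rewrite subvf.
  by move=> lU; case: nex; exists U.
have [W0 [nW0 W01 W0l W0P]] : exists W0, [/\ nice_vspace F n W0, (W0 <= W1)%VS,
    (\dim W0 <= l)%N & forall U, P U -> (\dim U <= l)%N -> (U <= W0)%VS].
  have [ex|nex] := lem (exists U, P U /\ (\dim U <= l)%N).
    have [W [PW lW] Wmax] := exists_max_dim ex; exists W; split=> //.
    - by case: PW => X _ [].
    - by case: W1P => h _; apply: h.
    - by move=> U PU Ul; apply: Ptot => //; apply: Wmax.
  (* With no span below [l], a nice space of least dimension inside [W1] serves as lower bound, and
     makes [Z] nice. *)
  have [W [nW WW1 dW]] := nice_min nW1; exists W; split=> //.
    by rewrite dW leq_addr.
  by move=> U PU Ul; case: nex; exists U.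
have [Z [W0Z ZW1 dZ]] : exists Z, [/\ (W0 <= Z)%VS, (Z <= W1)%VS & \dim Z = l].
  by apply: exists_between; rewrite // W0l.
have nZ := nice_vspaceS W0Z nW0.
have sZ : spans (points F Z) Z by [].
have [Y CY|Y [CY YZ]] := maxC _ (nice_points HL wn nZ).
  have [U YU] := chain_spans cC CY; have PU : P U by exists Y.
  case: (leqP (\dim U) l) => [Ul|/ltnW lU].
    by right; apply: (spans_psub YU sZ); apply: subv_trans W0Z; apply: W0P.
  by left; apply: (spans_psub sZ YU); apply: (subv_trans ZW1); case: W1P => _; apply.
by apply: noX; exists Y, Z; split=> //; split=> // p; split=> /YZ.
Qed.

(** One member is chosen for each dimension; any further member shares its dimension with a chosen
    one and so equals it. *)
Lemma maximal_chain_length C : maximal_chain F C -> chain_len_eq C d.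
Proof.
move=> maxC; have cC : chain F C by case: maxC.
have [X XP] := choice (fun k : 'I_d.+1 => maximal_chain_dim maxC (ltn_ord k : (k <= d)%N)).
have CX k : C (X k) by have [U []] := XP k.
exists X; split=> // [i j ij eX|Y CY].
  have [U [_ XU dU]] := XP i; have [W [_ XW dW]] := XP j.
  case/eqP: ij; apply/val_inj/eqP; rewrite -(eqn_add2l (n + n)) -dU -dW eqn_leq.
  rewrite (dimvS (spans_sub XU XW _)) => [|p /eX //].
  by rewrite (dimvS (spans_sub XW XU _)) // => p /eX.
have [U YU] := chain_spans cC CY; have nU := nice_dim (proj1 YU).
have lt : (\dim U - (n + n) < d.+1)%N by rewrite ltnS leq_subLR nice_dim_max.
exists (Ordinal lt); have [W [_ XW dW]] := XP (Ordinal lt).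
apply: (spans_dim_inj YU XW); first by case: cC => _; apply.
by rewrite dW /= subnKC.
Qed.

End Chains.

Theorem theorem3 (K : fieldType) (vT : vectType K) (F : @pform K vT) (n d : nat) :
  nondeg_form F -> (2 <= n)%N -> witt_index F n -> anisotropic_defect F n d ->
  ~ is_grid F n ->
  (forall C, chain F C -> chain_len_le C d) /\
  (forall C, chain F C -> (maximal_chain F C <-> chain_len_eq C d)).
Proof.
move=> /nondeg_form_laws[s [T HL]] n2 wn /(anisotropic_defect_split HL)[dV nV] _.
split=> C cC; first exact: (chain_length_le HL wn n2 dV).
split; first exact: (maximal_chain_length HL wn n2 dV nV).
exact: (chain_length_maximal HL wn n2 dV).
Qed.
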